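(* Let $0<r<R$ and let $\Omega=\{x\in\mathbb{R}^2: r<\|x\|_2<R\}$. Let $J_{\rm r},J_{\rm f}$ be positive integers, let $M\ge 1$, let $W_M:\mathbb{R}^M\to\mathcal{W}_{\rm hf}^{\rm pol}$ be a linear operator, and let $\mathbf{a}\in\mathbb{R}^M$. Set $\Phi_{\rm pol}=\mathrm{id}+W_M\mathbf{a}$ and $$\Phi=\Psi\circ\Phi_{\rm pol}\circ\Lambda .$$ If $\det(\nabla\Phi_{\rm pol})(x)>0$ for all $x\in[0,1]\times[-1/2,1/2]$, then $\Phi$ is a bijection from $\Omega$ onto itself.
   Context: Polar coordinates: $\widehat{\Omega}_{\rm pol}=(0,1)\times(-1/2,1/2)$ and $$\Psi(\rho,\theta)=(r+(R-r)\rho)\,(\cos(2\pi\theta),\sin(2\pi\theta)).$$ The formula for $\Psi$ is used for all $(\rho,\theta)\in\mathbb{R}^2$; it is $1$-periodic in $\theta$. $\Lambda=\Psi^{-1}$ is the inverse polar map: for $y\in\Omega$, $\Lambda(y)$ is the unique $(\rho,\theta)\in(0,1)\times[-1/2,1/2)$ with $\Psi(\rho,\theta)=y$. Spaces: $\mathbb{P}_{J_{\rm r}}$ is the space of real polynomials in one variable of degree at most $J_{\rm r}$, and $$\mathbb{F}_{J_{\rm f}}=\mathrm{span}\{1,\cos(2\pi x),\ldots,\cos(2\pi J_{\rm f}x),\sin(2\pi x),\ldots,\sin(2\pi J_{\rm f}x)\}.$$ Define $$\mathcal{W}_{\rm hf}^{\rm pol,\theta}=\mathrm{span}\{p(x)=p_1(x_1)p_2(x_2):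 p_1\in\mathbb{P}_{J_{\rm r}},\ p_2\in\mathbb{F}_{J_{\rm f}}\},$$ $$\mathcal{W}_{\rm hf}^{\rm pol,r}=\{p\in\mathcal{W}_{\rm hf}^{\rm pol,\theta}: p(x_1,x_2)=0 \text{ for all } x_1\in\{0,1\} \text{ and all } x_2\},$$ $$\mathcal{W}_{\rm hf}^{\rm pol}=\{\varphi=(\varphi_{\rm r},\varphi_\theta): \varphi_{\rm r}\in\mathcal{W}_{\rm hf}^{\rm pol,r},\ \varphi_\theta\in\mathcal{W}_{\rm hf}^{\rm pol,\theta}\}.$$ Here $x=(x_1,x_2)=(\rho,\theta)$. Elements of $\mathcal{W}_{\rm hf}^{\rm pol}$ are given by explicit formulas and are viewed as functions on $\mathbb{R}^2$ (or on the closure of $\widehat{\Omega}_{\rm pol}$). $\mathrm{id}$ is the identity map, and $\nabla\Phi_{\rm pol}$ is the $2\times 2$ Jacobian matrix of $\Phi_{\rm pol}$. *)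

(* Defs.v *)
From HB Require Import structures.
From mathcomp Require Import all_boot all_order all_algebra.
From mathcomp Require Import all_classical all_reals all_analysis.

Set Implicit Arguments.
Unset Strict Implicit.
Unset Printing Implicit Defensive.

Import Order.TTheory GRing.Theory Num.Theory.
Import numFieldNormedType.Exports.

Local Open Scope classical_set_scope.
Local Open Scope ring_scope.

Section LinearSpan.
Variables (R : pzRingType) (V : lmodType R).

Definition lspan (A : set V) : set V :=
  [set v | exists (n : nat) (c : 'I_n -> R) (g : 'I_n -> V),
     (forall i, A (g i)) /\ v = \sum_(i < n) c i *: g i].

End LinearSpan.

Section PolarDeformations.
Variable R : realType.

(* Points of the plane are row vectors 'rV[R]_2, with coordinates x 0 0 and
   x 0 1. *)
Definition vec2 (a b : R) : 'rV[R]_2 := \row_j (if j == 0 then a else b).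

(* The library norm on 'rV[R]_2 is the sup norm, hence this definition. *)
Definition norm2 (x : 'rV[R]_2) : R := Num.sqrt (x 0 0 ^+ 2 + x 0 1 ^+ 2).

Definition annulus (rin rout : R) : set 'rV[R]_2 :=
  [set x : 'rV[R]_2 | rin < norm2 x < rout].

Definition polar (rin rout : R) (x : 'rV[R]_2) : 'rV[R]_2 :=
  (rin + (rout - rin) * x 0 0) *:
    vec2 (cos (2 * pi * x 0 1)) (sin (2 * pi * x 0 1)).

(* If 0 < rin < rout and y is in the annulus, this set is a singleton;
   elsewhere the value is irrelevant (0 if the set is empty). *)
Definition inv_polar (rin rout : R) (y : 'rV[R]_2) : 'rV[R]_2 :=
  xget 0 [set x : 'rV[R]_2 | [/\ 0 < x 0 0 < 1, - (1 / 2) <= x 0 1 < 1 / 2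
                    & polar rin rout x = y]].

Definition polys (J : nat) : set (R -> R^o) :=
  [set f | exists p : {poly R}, (size p <= J.+1)%N /\ f = (fun x => p.[x])].

Definition trig_polys (J : nat) : set (R -> R^o) :=
  @lspan R (R -> R^o) ([set (fun=> 1)]
     `|` [set (fun x => cos (2 * pi * k%:R * x)) | k in [set k | (1 <= k <= J)%N]]
     `|` [set (fun x => sin (2 * pi * k%:R * x)) | k in [set k | (1 <= k <= J)%N]]).

Definition Whf_theta (Jr Jf : nat) : set ('rV[R]_2 -> R^o) :=
  lspan [set p | exists p1 p2, [/\ polys Jr p1, trig_polys Jf p2
                                 & p = (fun x : 'rV[R]_2 => p1 (x 0 0) * p2 (x 0 1))]].

Definition Whf_r (Jr Jf : nat) : set ('rV[R]_2 -> R^o) :=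
  [set p | Whf_theta Jr Jf p /\
           forall x : 'rV[R]_2, x 0 0 = 0 \/ x 0 0 = 1 -> p x = 0].

Definition Whf_pol (Jr Jf : nat) : set ('rV[R]_2 -> 'rV[R]_2) :=
  [set phi | Whf_r Jr Jf (fun x : 'rV[R]_2 => phi x 0 0) /\
             Whf_theta Jr Jf (fun x : 'rV[R]_2 => phi x 0 1)].

End PolarDeformations.

(* Main.v *)
(** Write F = Phi_pol on the strip S = [0,1] x R.  F commutes with the unit
    translation of the second variable, fixes the first coordinate on the
    boundary lines, and has positive Jacobian on S; it suffices to show that F
    is a bijection of the open strip.
    - F maps the open strip into itself: at an interior extremum of the first
      component its gradient would vanish.
    - Surjectivity: F differs from the identity by a bounded map on S, so
      |F - y|^2 attains its minimum over S; the minimum is not on the boundary,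
      and at an interior critical point F = y since the Jacobian is invertible.
    - Injectivity: F is injective on the boundary.  The double points (x, z),
      x <> z, F x = F z, form a closed set by local injectivity, so up to
      translation there is one minimising the first component of F.  It is
      interior, and since F is open at x and at z, there is a double point with
      a smaller first component, a contradiction. *)

Require Import Defs.
From HB Require Import structures.
From mathcomp Require Import all_boot all_order all_algebra.
From mathcomp Require Import all_classical all_reals all_analysis.
From mathcomp Require Import ring lra.

Set Implicit Arguments.
Unset Strict Implicit.
Unset Printing Implicit Defensive.

Import Order.TTheory GRing.Theory Num.Theory.
Import numFieldNormedType.Exports.

Local Open Scope classical_set_scope.
Local Open Scope ring_scope.

(** * Continuously differentiable functions *)

Section C1.
Variables (R : realType) (V : normedModType R).
Implicit Types (f g : V -> R) (x v : V).

(** Continuity is asked of each directional derivative separately; in finite dimension this amounts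
    to continuity of the differential. *)
Definition C1 f :=
  (forall x, differentiable f x) /\ (forall v, continuous (fun x => 'D_v f x)).

Lemma C1_continuous f : C1 f -> continuous f.
Proof. by case=> df _ x; exact: differentiable_continuous. Qed.

Lemma C1_cst (c : R) : C1 (fun _ : V => c).
Proof.
split=> [x|v]; first exact: differentiable_cst.
rewrite [X in continuous X](_ : _ = cst 0); first by move=> x; exact: cvg_cst.
by apply/funext => x; exact: derive_cst.
Qed.

Lemma C1D f g : C1 f -> C1 g -> C1 (fun x => f x + g x).
Proof.
move=> [df cf] [dg cg]; split=> [x|v]; first exact: differentiableD.
rewrite [X in continuous X](_ : _ = 'D_v f \+ 'D_v g).
  by move=> x; exact: cvgD (cf v x) (cg v x).
by apply/funext => x; rewrite deriveD//; exact: diff_derivable.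
Qed.

Lemma C1M f g : C1 f -> C1 g -> C1 (fun x => f x * g x).
Proof.
move=> cf1 cg1; have [[df cf] [dg cg]] := (cf1, cg1).
split=> [x|v]; first exact: differentiableM.
rewrite [X in continuous X](_ : _ = (fun x => f x * 'D_v g x + g x * 'D_v f x)).
  move=> x; exact: cvgD (cvgM (@C1_continuous f cf1 x) (cg v x))
    (cvgM (@C1_continuous g cg1 x) (cf v x)).
by apply/funext => x; rewrite deriveM//; exact: diff_derivable.
Qed.

Lemma is_derive_line f x v (t : R) : (forall x, differentiable f x) ->
  is_derive t 1 (fun t : R => f (x + t *: v)) ('D_v f (x + t *: v)).
Proof.
move=> df.
have dl : is_diff t (fun t : R => x + t *: v) (fun h : R => h *: v).
  have -> : (fun h : R => h *: v) = 0 + ( *:%R^~ v) by rewrite add0r.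
  exact: is_diffD.
have dc : differentiable (f \o (fun t : R => x + t *: v)) t.
  exact: differentiable_comp.
apply: DeriveDef; first exact: diff_derivable.
by rewrite deriveE// diff_comp//= diff_val scale1r deriveE.
Qed.

Lemma mvt_line f x y : (forall x, differentiable f x) ->
  exists2 t : R, 0 <= t <= 1 & f y - f x = 'D_(y - x) f (x + t *: (y - x)).
Proof.
move=> df.
have [||t] := @MVT_segment R (fun t => f (x + t *: (y - x)))
  (fun t => 'D_(y - x) f (x + t *: (y - x))) 0 1 ler01.
- by move=> t _; exact: is_derive_line.
- apply: continuous_subspaceT => t.
  apply: differentiable_continuous; apply/derivable1_diffP.
  by case: (is_derive_line x (y - x) t df).
rewrite in_itv/= => t01; rewrite scale1r scale0r addr0 subrKC subr0 mulr1 => E.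
by exists t.
Qed.

(** The derivative is also the limit of the difference quotients over t > 0, all of them
    nonnegative. The one-sided form serves at boundary points of the strip, where only inward steps
    are allowed. *)
Lemma derive_ge0_right f x v (e : R) : differentiable f x -> 0 < e ->
  (forall t, 0 < t < e -> f x <= f (x + t *: v)) -> 0 <= 'D_v f x.
Proof.
move=> df e0 fx.
have dv : derivable f x v by exact: diff_derivable.
rewrite /derive cvg_at_rightE//.
apply: limr_ge.
  rewrite -(cvg_at_rightE (fun h : R => h^-1 *: ((f \o shift x) (h *: v) - f x)))//.
  apply: cvg_trans dv; apply: cvg_app.
  by move=> A [d d0 Ad]; exists d => // t td t0; apply: Ad => //; exact/lt0r_neq0.
near=> t.
have t0 : 0 < t by near: t; exact: nbhs_right_gt.
rewrite /= mulr_ge0 ?invr_ge0 ?(ltW t0)// subr_ge0 addrC fx// t0/=.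
by near: t; exact: nbhs_right_lt.
Unshelve. all: by end_near. Qed.

End C1.

Lemma derive_oppv (R : realType) (V : normedModType R) (f : V -> R) x v :
  differentiable f x -> 'D_(- v) f x = - 'D_v f x.
Proof. by move=> df; rewrite !deriveE// linearN. Qed.

Lemma derive_local_min (R : realType) (V : normedModType R) (f : V -> R) x v :
  differentiable f x -> (\forall z \near x, f x <= f z) -> 'D_v f x = 0.
Proof.
move=> df fx.
suff ge0 w : 0 <= 'D_w f x.
  by apply/eqP; rewrite eq_le ge0 andbT -oppr_ge0 -derive_oppv.
have [e /= e0 He] := (nbhs_normP _ _).1 fx.
(* Steps t < e / (|w| + 1) keep x + t w in the ball of radius e; the added 1 covers w = 0. *)
have w0 : 0 < `|w| + 1 by rewrite ltr_wpDl.
apply: (@derive_ge0_right _ _ f x w (e / (`|w| + 1))) => //.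
  by rewrite divr_gt0.
move=> t /andP[t0 te]; apply: He => /=.
rewrite opprD addrA subrr sub0r normrN normrZ gtr0_norm//.
move: te; rewrite ltr_pdivlMr//; apply: le_lt_trans.
by rewrite ler_pM2l// lerDl.
Qed.

(** * Extrema on boxes and on the periodic strip *)

Section Plane.
Variable R : realType.
Local Notation vec := 'rV[R]_2.
Implicit Types (x y z v : vec) (f g h : vec -> R).

Lemma vec2_0 (a b : R) : vec2 a b 0 0 = a.
Proof. by rewrite mxE. Qed.

Lemma vec2_1 (a b : R) : vec2 a b 0 1 = b.
Proof. by rewrite mxE. Qed.

Definition vec2E := (vec2_0, vec2_1).

Lemma vec2_ext x y : x 0 0 = y 0 0 -> x 0 1 = y 0 1 -> x = y.
Proof.
move=> e0 e1; apply/rowP => i; case: i => -[|[|//]] p.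
  by rewrite (_ : Ordinal p = 0)//; apply: val_inj.
by rewrite (_ : Ordinal p = 1)//; apply: val_inj.
Qed.

Local Notation e0 := (vec2 (1 : R) 0).
Local Notation e1 := (vec2 (0 : R) 1).

Lemma derive_vec2 f x v : differentiable f x ->
  'D_v f x = v 0 0 * 'D_e0 f x + v 0 1 * 'D_e1 f x.
Proof.
move=> df; rewrite !deriveE//.
rewrite {1}(_ : v = v 0 0 *: e0 + v 0 1 *: e1) ?linearD ?linearZ//=.
by apply: vec2_ext; rewrite !(mxE, vec2E)/=; ring.
Qed.

Lemma coord_cvg (i : 'I_2) : continuous (fun x : vec => x 0 i : R).
Proof. by move=> x; exact: coord_continuous. Qed.

Lemma compact_box (a b c d : R) :
  compact [set x : vec | a <= x 0 0 <= b /\ c <= x 0 1 <= d].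
Proof.
pose A (i : 'I_2) : set R := if i == 0 then `[a, b]%classic else `[c, d]%classic.
have cA : forall i, compact (A i).
  by move=> i; rewrite /A; case: ifP => _; exact: segment_compact.
rewrite [X in compact X](_ : _ = [set v : vec | forall i, A i (v ord0 i)]).
  exact: rV_compact.
apply/seteqP; split => [x [/= x0 x1]|x /= Hx].
  move=> [[|[|//]] p]; rewrite /A/= in_itv/=.
    by rewrite (_ : Ordinal p = 0)//; apply: val_inj.
  by rewrite (_ : Ordinal p = 1)//; apply: val_inj.
by have := (Hx 0, Hx 1); rewrite /A/= !in_itv/= => -[].
Qed.

Lemma box_min f (a b c d : R) : a <= b -> c <= d -> continuous f ->
  exists2 x : vec, a <= x 0 0 <= b /\ c <= x 0 1 <= d &
    forall y, a <= y 0 0 <= b -> c <= y 0 1 <= d -> f x <= f y.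
Proof.
move=> ab cd cf.
have B0 : [set x : vec | a <= x 0 0 <= b /\ c <= x 0 1 <= d] !=set0.
  by exists (vec2 a c); rewrite /= !vec2E !lexx ab cd.
have [x xB xmin] := EVT_min_rV B0 (@compact_box a b c d) (continuous_subspaceT cf).
exists x; first by move: xB; rewrite inE.
by move=> y y0 y1; apply: xmin; rewrite inE.
Qed.

Lemma near_open_strip x : 0 < x 0 0 < 1 -> \forall z \near x, 0 < (z : vec) 0 0 < 1.
Proof.
move=> /andP[x0 x1]; near=> z; apply/andP; split; near: z.
  exact: (@cvgr_gt _ _ _ _ (fun z : vec => z 0 0) _ (@coord_cvg 0 x)).
exact: (@cvgr_lt _ _ _ _ (fun z : vec => z 0 0) _ (@coord_cvg 0 x)).
Unshelve. all: by end_near. Qed.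

Lemma int_shift (t : R) : exists k : int, - (1 / 2) <= t + k%:~R < 1 / 2.
Proof.
exists (- Num.floor (t + 1 / 2)).
have := real_floor_itv (num_real (t + 1 / 2)).
by rewrite rmorphN/= rmorphD/=; lra.
Qed.

(** The increment c lets one statement serve both components of the map: c = 0 for the first, c = 1
    for the second. *)
Lemma periodicZ f (c : R) : (forall x, f (x + e1) = f x + c) ->
  forall x (k : int), f (x + k%:~R *: e1) = f x + k%:~R * c.
Proof.
move=> fe.
have N x (n : nat) : f (x + n%:R *: e1) = f x + n%:R * c.
  elim: n => [|n IH]; first by rewrite scale0r mul0r !addr0.
  by rewrite -natr1 scalerDl scale1r addrA fe IH mulrDl mul1r addrA.
move=> x [n|n]; first exact: N.
rewrite NegzE rmorphN/= mulNr scaleNr.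
(* A negative translation is undone by the natural case at the translated point. *)
have /eqP := N (x - n.+1%:R *: e1) n.+1.
by rewrite subrK -subr_eq => /eqP <-.
Qed.

(** By periodicity the minimum over one period, a compact box, is the minimum over the whole
    strip. *)
Lemma strip_min f : continuous f -> (forall x, f (x + e1) = f x) ->
  exists2 x : vec, 0 <= x 0 0 <= 1 & forall y, 0 <= y 0 0 <= 1 -> f x <= f y.
Proof.
move=> cf fe.
have h : - (1 / 2) <= 1 / 2 :> R by lra.
have [x [x0 _] xm] := box_min ler01 h cf.
exists x => // y y0; have [k yk] := int_shift (y 0 1).
have fe' : forall x, f (x + e1) = f x + 0 by move=> z; rewrite addr0.
have -> : f y = f (y + k%:~R *: e1) by rewrite (periodicZ fe') mulr0 addr0.
by apply: xm; rewrite !(mxE, vec2E)/= ?mulr0 ?addr0// mulr1; lra.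
Qed.

(** A minimum principle. Without interior critical points the minimum over the strip is attained
    only on the boundary, where f is nonnegative; an interior point with f x <= 0 would then be a
    minimiser itself. *)
Lemma strip_gt0 f : C1 f -> (forall x, f (x + e1) = f x) ->
  (forall x, x 0 0 = 0 \/ x 0 0 = 1 -> 0 <= f x) ->
  (forall x, 0 < x 0 0 < 1 -> 'D_e0 f x != 0 \/ 'D_e1 f x != 0) ->
  forall x, 0 < x 0 0 < 1 -> 0 < f x.
Proof.
move=> Cf fe f_bd f_crit.
have no_min x : 0 < x 0 0 < 1 -> (forall y, 0 <= y 0 0 <= 1 -> f x <= f y) -> False.
  move=> x01 xm.
  have D v : 'D_v f x = 0.
    apply: derive_local_min; first exact: Cf.1.
    near=> z; apply: xm.
    suff /andP[/ltW -> /ltW ->] : 0 < z 0 0 < 1 by [].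
    by near: z; exact: near_open_strip.
  by case: (f_crit x x01); rewrite D eqxx.
move=> x x01; rewrite ltNge; apply/negP => fx0.
have [c c01 cm] := strip_min (C1_continuous Cf) fe.
have fc : f c = 0 \/ f c < 0.
  have := cm x; have /andP[/ltW -> /ltW ->] := x01 => /(_ isT) H.
  have := le_trans H fx0; rewrite le_eqVlt => /orP[/eqP|]; by [left|right].
have cb : c 0 0 = 0 \/ c 0 0 = 1.
  have /andP[] := c01; rewrite !le_eqVlt => /orP[/eqP|c0]; first by left.
  move=> /orP[/eqP|c1]; first by right.
  by exfalso; apply: (@no_min c) => //; rewrite c0.
have f0 := f_bd c cb.
apply: (@no_min x) => // y /cm; apply: le_trans.
by apply: le_trans fx0 f0.
Unshelve. all: by end_near. Qed.

End Plane.

(** * Local inversion in the plane *)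

Lemma dist_continuous (R : realType) (V : normedModType R) (x : V) :
  continuous (fun z => `|x - z|).
Proof. by move=> z; exact: cvg_norm (cvgB (cvg_cst x) cvg_id). Qed.

Section InverseFunction.
Variable R : realType.
Local Notation vec := 'rV[R]_2.
Local Notation e0 := (vec2 (1 : R) 0).
Local Notation e1 := (vec2 (0 : R) 1).
Implicit Types x z v : vec.

Lemma ball_segment (V : normedModType R) (x p q : V) (r t : R) : 0 <= t <= 1 ->
  `|x - p| < r -> `|x - q| < r -> `|x - (p + t *: (q - p))| < r.
Proof.
move=> /andP[t0 t1] pr qr.
have -> : x - (p + t *: (q - p)) = (1 - t) *: (x - p) + t *: (x - q).
  have -> : q - p = (x - p) - (x - q) by rewrite opprB [RHS]addrC addrA subrK.
  rewrite scalerBr scalerBl scale1r opprD addrA opprB.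
  by rewrite [LHS]addrA [LHS]addrAC.
apply: le_lt_trans (ler_normD _ _) _; rewrite !normrZ ger0_norm ?subr_ge0//.
rewrite ger0_norm//.
(* Strictness will come from the term of weight t, so t = 0 is treated apart. *)
have := t0; rewrite le_eqVlt => /orP[/eqP <-|tp]; first by rewrite subr0 mul1r mul0r addr0.
rewrite [X in _ < X](_ : r = (1 - t) * r + t * r); last by ring.
by rewrite ler_ltD// ?ltr_pM2l// ler_wpM2l ?subr_ge0// ltW.
Qed.

Variables F0 F1 : vec -> R.
Hypotheses (CF0 : C1 F0) (CF1 : C1 F1).

Definition jac x := 'D_e0 F0 x * 'D_e1 F1 x - 'D_e1 F0 x * 'D_e0 F1 x.

(** Cramer's rule: the determinant times an unknown is a combination of the two left-hand sides. *)
Lemma linear_solve2 (a b c d u v : R) : a * d - b * c != 0 ->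
  u * a + v * b = 0 -> u * c + v * d = 0 -> u = 0 /\ v = 0.
Proof.
move=> D E1 E2; split; apply: (mulIf D); rewrite mul0r.
  have -> : u * (a * d - b * c) = (u * a + v * b) * d - b * (u * c + v * d) by ring.
  by rewrite E1 E2 mul0r mulr0 subrr.
have -> : v * (a * d - b * c) = (u * c + v * d) * a - c * (u * a + v * b) by ring.
by rewrite E1 E2 mul0r mulr0 subrr.
Qed.

(** If F p = F q near x, the mean value theorem makes q - p a null vector of a matrix of derivatives
    taken on the segment, and by continuity this matrix is still invertible. *)
Lemma locally_injective x : jac x != 0 ->
  exists2 r : R, 0 < r & forall p q, `|x - p| < r -> `|x - q| < r ->
    F0 p = F0 q -> F1 p = F1 q -> p = q.
Proof.
move=> Jx.
(* The two rows of the Jacobian are evaluated at different points because the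
   mean value theorem is applied to each coordinate separately. *)
pose H (z : vec * vec) := 'D_e0 F0 z.1 * 'D_e1 F1 z.2 - 'D_e1 F0 z.1 * 'D_e0 F1 z.2.
have cH : {for (x, x), continuous H}.
  have [[_ c0] [_ c1]] := (CF0, CF1).
  have F a : (fun z : vec * vec => 'D_a F0 z.1) @ (x, x) --> 'D_a F0 x.
    by apply: (@cvg_comp _ _ _ fst ('D_a F0) _ _ _ cvg_fst); exact: c0.
  have G a : (fun z : vec * vec => 'D_a F1 z.2) @ (x, x) --> 'D_a F1 x.
    by apply: (@cvg_comp _ _ _ snd ('D_a F1) _ _ _ cvg_snd); exact: c1.
  exact: cvgB (cvgM (F _) (G _)) (cvgM (F _) (G _)).
have : \forall z \near (x, x), H z != 0 by exact: cvgr_neq0 cH Jx.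
move=> /nbhs_ballP[r /= r0 Hr]; exists r => // p q px qx E0 E1.
have [s s01 Es] := mvt_line p q CF0.1.
have [t t01 Et] := mvt_line p q CF1.1.
move: Es Et; rewrite E0 E1 !subrr.
rewrite (derive_vec2 _ (CF0.1 _)) (derive_vec2 _ (CF1.1 _)) => /esym Es /esym Et.
have := Hr (p + s *: (q - p), p + t *: (q - p)).
have Hb u : 0 <= u <= 1 -> ball x r (p + u *: (q - p)).
  by move=> u01; rewrite -ball_normE; exact: ball_segment.
move=> /(_ (conj (Hb s s01) (Hb t t01))) => /linear_solve2 /(_ Es Et).
rewrite !mxE => -[/eqP + /eqP]; rewrite !subr_eq0 => /eqP h0 /eqP h1.
exact: vec2_ext.
Qed.

Definition sqdist (y0 y1 : R) x := (F0 x - y0) ^+ 2 + (F1 x - y1) ^+ 2.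

Lemma C1_sqdist y0 y1 : C1 (sqdist y0 y1).
Proof.
have S (f : vec -> R) (c : R) : C1 f -> C1 (fun x => (f x - c) ^+ 2).
  move=> Cf; have Cfc : C1 (fun x => f x - c) by apply: C1D => //; exact: C1_cst.
  by under eq_fun do rewrite expr2; exact: C1M.
by apply: C1D; exact: S.
Qed.

Lemma derive_sqdist y0 y1 x v : 'D_v (sqdist y0 y1) x =
  2 * ((F0 x - y0) * 'D_v F0 x + (F1 x - y1) * 'D_v F1 x).
Proof.
have S (f : vec -> R) (c : R) : C1 f ->
    is_derive x v (fun x => (f x - c) ^+ 2) (2 * ((f x - c) * 'D_v f x)).
  move=> Cf.
  have df : is_derive x v f ('D_v f x) by apply: DeriveDef => //; exact/diff_derivable/Cf.1.
  have dfc : is_derive x v (fun x => f x - c) ('D_v f x).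
    by apply: is_derive_eq (is_deriveB df (is_derive_cst c x v)) _; rewrite subr0.
  apply: is_derive_eq (is_deriveX 2 dfc) _.
  by rewrite /= expr1 -[_ *: _]/(_ * _); ring.
rewrite mulrDr.
by have [_ ->] := is_deriveD (S F0 y0 CF0) (S F1 y1 CF1).
Qed.

(** At a critical point the transposed Jacobian matrix annihilates F x - y. *)
Lemma sqdist_local_min y0 y1 x : jac x != 0 ->
  (\forall z \near x, sqdist y0 y1 x <= sqdist y0 y1 z) -> F0 x = y0 /\ F1 x = y1.
Proof.
move=> Jx xm.
have D v : (F0 x - y0) * 'D_v F0 x + (F1 x - y1) * 'D_v F1 x = 0.
  have /eqP := derive_local_min v ((C1_sqdist y0 y1).1 x) xm.
  by rewrite derive_sqdist mulf_eq0 pnatr_eq0/= => /eqP.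
have J' : 'D_e0 F0 x * 'D_e1 F1 x - 'D_e0 F1 x * 'D_e1 F0 x != 0.
  by rewrite [X in _ - X]mulrC.
have [/eqP + /eqP] := linear_solve2 J' (D e0) (D e1).
by rewrite !subr_eq0 => /eqP -> /eqP ->.
Qed.

(** On a small sphere around x, local injectivity keeps F away from F x. For y close to F x, the
    minimiser of |F - y|^2 over the closed ball is therefore interior, and there F = y. *)
Lemma locally_open x (r : R) : 0 < r -> (forall z, `|x - z| < r -> jac z != 0) ->
  exists2 d : R, 0 < d & forall y0 y1 : R,
    (F0 x - y0) ^+ 2 < d -> (F1 x - y1) ^+ 2 < d ->
    exists z, [/\ `|x - z| < r, F0 z = y0 & F1 z = y1].
Proof.
move=> r0 Jr.
have Jx : jac x != 0 by apply: Jr; rewrite subrr normr0.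
have [r1 r10 inj] := locally_injective Jx.
(* Halving puts the closed ball of radius s inside both open balls. *)
pose s := Num.min r r1 / 2.
have s0 : 0 < s by rewrite divr_gt0// lt_min r0 r10.
have [sr sr1] : s < r /\ s < r1.
  by apply/andP; rewrite -lt_min /s ltr_pdivrMr// ltr_pMr ?lt_min ?r0 ?r10// ltr1n.
have cn := @dist_continuous R vec x.
have cB : compact [set z : vec | `|x - z| <= s].
  apply: bounded_closed_compact; last first.
    exact: (continuous_closedP _).1 cn _ (@closed_le _ s).
  exists (`|x| + s); split; first exact: num_real.
  move=> M Mx z /= zs; rewrite -(subKr x z).
  by apply: le_trans (ltW Mx); apply: le_trans (ler_normB _ _) _; rewrite lerD2l.
have cS : compact [set z : vec | `|x - z| = s].
  apply: subclosed_compact cB _.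
    exact: (continuous_closedP _).1 cn _ (@closed_eq _ s).
  by move=> z /= ->.
have cQ y0 y1 : continuous (sqdist y0 y1) by exact/C1_continuous/C1_sqdist.
have S0 : [set z : vec | `|x - z| = s] !=set0.
  have e0n : `|e0| != 0.
    rewrite normr_eq0; apply/eqP => /rowP /(_ 0).
    by rewrite !mxE/= => /eqP; rewrite oner_eq0.
  exists (x - (s / `|e0|) *: e0) => /=.
  rewrite opprB addrC subrK normrZ ger0_norm ?divfK//.
  by apply: mulr_ge0; [exact: ltW|rewrite invr_ge0].
have [c cS' cm] := EVT_min_rV S0 cS (continuous_subspaceT (cQ (F0 x) (F1 x))).
have m0 : 0 < sqdist (F0 x) (F1 x) c.
  rewrite lt_neqAle addr_ge0 ?sqr_ge0// andbT eq_sym paddr_eq0 ?sqr_ge0//.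
  rewrite !sqrf_eq0 !subr_eq0; apply/negP => /andP[/eqP h0 /eqP h1].
  move: cS'; rewrite inE /= => cs.
  have xc : c = x by apply: inj => //; rewrite ?cs// subrr normr0.
  by move: cs; rewrite xc subrr normr0 => s00; move: s0; rewrite -s00 ltxx.
(* Let m be the minimum of |F - F x|^2 on the sphere. A minimiser z on the sphere would give m <= |F
   z - F x|^2 <= 2 |F z - y|^2 + 2 |F x - y|^2 <= 4 |F x - y|^2 < 8 d, so d = m / 8 excludes it. *)
exists (sqdist (F0 x) (F1 x) c / 8); first by rewrite divr_gt0.
move=> y0 y1 h0 h1.
have B0 : [set z : vec | `|x - z| <= s] !=set0.
  by exists x; rewrite /= subrr normr0 ltW.
have [z zB zm] := EVT_min_rV B0 cB (continuous_subspaceT (cQ y0 y1)).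
have zs : `|x - z| < s.
  move: zB; rewrite inE/= le_eqVlt => /orP[/eqP zs|//]; exfalso.
  have := zm x; rewrite inE/= subrr normr0 (ltW s0) => /(_ isT).
  have := cm z; rewrite inE/= zs => /(_ erefl).
  move: m0 h0 h1; move: (sqdist _ _ c) => m; rewrite /sqdist.
  have := sqr_ge0 (F0 z - y0 + (F0 x - y0)).
  have := sqr_ge0 (F1 z - y1 + (F1 x - y1)).
  by lra.
exists z; suff [-> ->] : F0 z = y0 /\ F1 z = y1 by split=> //; exact: lt_trans sr.
apply: sqdist_local_min; first by apply: Jr; exact: lt_trans sr.
near=> w; apply: zm; rewrite inE/=; apply: ltW; near: w.
exact: (@cvgr_lt _ _ _ _ (fun z : vec => `|x - z|) _ (cn z)).
Unshelve. all: by end_near. Qed.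

End InverseFunction.

(** * Maps of the strip *)

Section StripMap.
Variable R : realType.
Local Notation vec := 'rV[R]_2.
Local Notation e0 := (vec2 (1 : R) 0).
Local Notation e1 := (vec2 (0 : R) 1).
(** The components of [Phi_pol], reduced to the properties that the strip argument uses. *)
Variables F0 F1 : vec -> R.
Hypotheses (CF0 : C1 F0) (CF1 : C1 F1).
Hypothesis F0_periodic : forall x, F0 (x + e1) = F0 x.
Hypothesis F1_periodic : forall x, F1 (x + e1) = F1 x + 1.
Hypothesis F0_bd : forall x : vec, x 0 0 = 0 \/ x 0 0 = 1 -> F0 x = x 0 0.
Hypothesis jac_gt0 : forall x : vec, 0 <= x 0 0 <= 1 -> 0 < jac F0 F1 x.
Implicit Types x z v : vec.

Lemma oo_subset_cc (t : R) : 0 < t < 1 -> 0 <= t <= 1.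
Proof. by move=> /andP[/ltW -> /ltW ->]. Qed.

Lemma endpoint_cc (t : R) : t = 0 \/ t = 1 -> 0 <= t <= 1.
Proof. by case=> ->; rewrite lexx ler01. Qed.

Lemma grad_F0_neq0 x : 0 < x 0 0 < 1 -> 'D_e0 F0 x != 0 \/ 'D_e1 F0 x != 0.
Proof.
move=> /oo_subset_cc/jac_gt0; rewrite /jac => J.
have [D0|] := eqVneq ('D_e0 F0 x) 0; last by left.
have [D1|] := eqVneq ('D_e1 F0 x) 0; last by right.
by move: J; rewrite D0 D1 !mul0r subrr ltxx.
Qed.

(** The minimum principle is applied to [F0] and to 1 - [F0]. *)
Lemma F0_itv x : 0 < x 0 0 < 1 -> 0 < F0 x < 1.
Proof.
move=> x01; apply/andP; split.
  apply: (strip_gt0 CF0 F0_periodic _ grad_F0_neq0 x01).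
  by move=> z zb; rewrite F0_bd//; have /andP[] := endpoint_cc zb.
(* 1 - [F0] is written as 1 + (-1) * [F0] to fit [C1D] and [C1M]. *)
have E z v : 'D_v (fun x => 1 + (-1) * F0 x) z = - 'D_v F0 z.
  have df : is_derive z v F0 ('D_v F0 z).
    by apply: DeriveDef => //; exact/diff_derivable/CF0.1.
  have [_ ->] := is_deriveD (is_derive_cst (1 : R) z v) (is_deriveZ (-1) df).
  by rewrite add0r scaleN1r.
rewrite -subr_gt0 -[1 - F0 x]/(1 + - F0 x) -mulN1r.
apply: (@strip_gt0 _ (fun x => 1 + (-1) * F0 x)) x01.
- by apply: C1D; [exact: C1_cst|apply: C1M => //; exact: C1_cst].
- by move=> z; rewrite F0_periodic.
- move=> z zb; rewrite F0_bd// mulN1r subr_ge0.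
  by have /andP[] := endpoint_cc zb.
- by move=> z; rewrite !E !oppr_eq0; exact: grad_F0_neq0.
Qed.

Lemma shift_e1 x (t : R) : (x + t *: e1) 0 0 = x 0 0.
Proof. by rewrite !mxE/= mulr0 addr0. Qed.

Lemma shift_e0 x (t : R) : (x + t *: e0) 0 0 = x 0 0 + t.
Proof. by rewrite !mxE/= mulr1. Qed.

(** [F0] is constant along a boundary line and maps the interior to (0,1), so its tangential
    derivative is 0 and its derivative along [e0] is nonnegative. The Jacobian reduces to the
    product of the two remaining derivatives, which forces both to be positive. *)
Lemma boundary_derive x : x 0 0 = 0 \/ x 0 0 = 1 ->
  [/\ 0 < 'D_e0 F0 x, 'D_e1 F0 x = 0 & 0 < 'D_e1 F1 x].
Proof.
move=> xb.
have d0 := CF0.1 x.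
have D1 : 'D_e1 F0 x = 0.
  apply/eqP; rewrite eq_le; apply/andP; split.
    rewrite -oppr_ge0 -derive_oppv//; apply: (derive_ge0_right d0 ltr01).
    by move=> t _; rewrite scalerN -scaleNr !F0_bd ?shift_e1.
  apply: (derive_ge0_right d0 ltr01).
  by move=> t _; rewrite !F0_bd ?shift_e1.
have D0 : 0 <= 'D_e0 F0 x.
  case: xb => xb.
    apply: (derive_ge0_right d0 ltr01) => t t01.
    rewrite F0_bd ?xb; last by left.
    have /F0_itv/andP[/ltW//] : 0 < (x + t *: e0) 0 0 < 1.
    by rewrite shift_e0 xb add0r.
  have dN : differentiable (- F0) x by exact: differentiableN.
  suff : 0 <= 'D_(- e0) (- F0) x.
    by rewrite derive_oppv// deriveN ?opprK//; exact: diff_derivable.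
  apply: (derive_ge0_right dN ltr01).
  move=> t t01; rewrite !fctE lerN2 (F0_bd (or_intror xb)) xb.
  have /F0_itv/andP[_ /ltW//] : 0 < (x + t *: - e0) 0 0 < 1.
  by rewrite scalerN -scaleNr shift_e0 xb; lra.
have := jac_gt0 (endpoint_cc xb); rewrite /jac D1 mul0r subr0 => J.
have D0' : 0 < 'D_e0 F0 x.
  rewrite lt_neqAle D0 andbT eq_sym; apply/eqP => h.
  by move: J; rewrite h mul0r ltxx.
by split=> //; move: J; rewrite pmulr_rgt0.
Qed.

(** [F1] has positive derivative along each boundary line. *)
Lemma boundary_inj x z : x 0 0 = 0 \/ x 0 0 = 1 -> z 0 0 = x 0 0 ->
  F1 x = F1 z -> x = z.
Proof.
move=> xb zx E.
have [t _] := mvt_line x z CF1.1.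
rewrite derive_vec2; last exact: CF1.1.
have h0 : (z - x) 0 0 = 0 by rewrite !mxE zx subrr.
rewrite E subrr h0 mul0r add0r => /esym/eqP; rewrite mulf_eq0.
have [|_ _ /lt0r_neq0/negbTE ->] := @boundary_derive (x + t *: (z - x)).
  by rewrite mxE [X in _ + X]mxE h0 mulr0 addr0.
rewrite orbF => /eqP h1; apply/esym/vec2_ext => //.
by apply/eqP; rewrite -subr_eq0; apply/eqP; move: h1; rewrite !mxE.
Qed.

(** The displacement is continuous and periodic, hence bounded by its extrema on the strip. *)
Lemma F1_displacement : exists2 K : R, 0 <= K &
  forall x, 0 <= x 0 0 <= 1 -> `|F1 x - x 0 1| <= K.
Proof.
pose g x := F1 x - x 0 1.
have cg : continuous g.
  by move=> x; exact: cvgB (@C1_continuous _ _ F1 CF1 x) (@coord_cvg R 1 x).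
have gp x : g (x + e1) = g x.
  by rewrite /g F1_periodic !mxE/=; ring.
have cNg : continuous (fun x => - g x) by move=> x; exact: cvgN (cg x).
have [a a01 am] := strip_min cg gp.
have [b b01 bM] : exists2 x : vec, 0 <= x 0 0 <= 1 &
    forall z : vec, 0 <= z 0 0 <= 1 -> - g x <= - g z.
  by apply: strip_min => // x; rewrite gp.
exists (`|g a| + `|g b|); first by rewrite addr_ge0.
move=> x x01; rewrite ler_norml.
have := am x x01; have := bM x x01; rewrite lerN2 -/(g x).
have := ler_norm (g b); have := ler_norm (- g a); rewrite normrN.
have := normr_ge0 (g a); have := normr_ge0 (g b).
by move=> *; apply/andP; split; lra.
Qed.

Lemma strip_map_surj (y0 y1 : R) : 0 < y0 < 1 ->
  exists x, [/\ 0 < x 0 0 < 1, F0 x = y0 & F1 x = y1].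
Proof.
move=> y01.
have [K K0 HK] := F1_displacement.
(* If z is more than L away from y1 in the second coordinate, then |F1 z - y1| >= L - K = K + 2. The
   squared distance at z then exceeds 1 + K^2, a bound for its value at (0, y1), so the minimum over
   the box is one over the strip. *)
pose L := 2 * K + 2.
have yL : y1 - L <= y1 + L by rewrite /L; lra.
have [x [x0 x1] xm'] := box_min ler01 yL (C1_continuous (C1_sqdist CF0 CF1 y0 y1)).
have xm z : 0 <= z 0 0 <= 1 -> sqdist F0 F1 y0 y1 x <= sqdist F0 F1 y0 y1 z.
  move=> z01; have [zL|zL] := boolP (y1 - L <= z 0 1 <= y1 + L); first exact: xm'.
  pose w : vec := vec2 0 y1.
  have w0 : w 0 0 = 0 by rewrite vec2E.
  have w1 : w 0 1 = y1 by rewrite vec2E.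
  have wle : sqdist F0 F1 y0 y1 w <= 1 + K ^+ 2.
    have := HK w; rewrite w0 w1 lexx ler01 => /(_ isT).
    rewrite /sqdist F0_bd ?w0; last by left.
    rewrite ler_norml => /andP[k1 k2]; nra.
  apply: le_trans (xm' w _ _) _; rewrite ?w0 ?w1 ?lexx ?ler01//.
    by rewrite /L; lra.
  apply: le_trans wle _; rewrite /sqdist.
  have := HK z z01; rewrite ler_norml => /andP[k1 k2].
  have s0 := sqr_ge0 (F0 z - y0).
  have : K + 2 <= F1 z - y1 \/ F1 z - y1 <= - (K + 2).
    by move: zL; rewrite negb_and -!ltNge /L => /orP[]; [right|left]; lra.
  by case=> h; nra.
have interior : 0 < x 0 0 < 1.
  have noD v : 0 <= 'D_v (sqdist F0 F1 y0 y1) x -> 'D_v (sqdist F0 F1 y0 y1) x < 0 -> False.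
    by move=> h1 /(le_lt_trans h1); rewrite ltxx.
  have dS := (C1_sqdist CF0 CF1 y0 y1).1 x.
  suff nb : ~ (x 0 0 = 0 \/ x 0 0 = 1).
    move: x0 => /andP[x00 x01]; rewrite !lt_neqAle x00 x01 !andbT.
    by apply/andP; split; apply/eqP => h; apply: nb; [left|right].
  (* The tangential derivative forces F1 x = y1, and then moving inwards
     decreases the distance. *)
  move=> xb; have [D0 D1 E1] := boundary_derive xb.
  have S1 : 'D_e1 (sqdist F0 F1 y0 y1) x = 0.
    apply/eqP; rewrite eq_le; apply/andP; split.
      rewrite -oppr_ge0 -derive_oppv//; apply: (derive_ge0_right dS ltr01).
      by move=> t _; apply: xm; rewrite scalerN -scaleNr shift_e1.
    by apply: (derive_ge0_right dS ltr01) => t _; apply: xm; rewrite shift_e1.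
  move: S1; rewrite derive_sqdist// D1 mulr0 add0r => /eqP.
  rewrite !mulf_eq0 pnatr_eq0/= (negbTE (lt0r_neq0 E1)) orbF => /eqP F1x.
  case: xb => xb.
    have : 0 <= 'D_e0 (sqdist F0 F1 y0 y1) x.
      apply: (derive_ge0_right dS ltr01) => t t01; apply: xm.
      by rewrite shift_e0 xb; lra.
    rewrite derive_sqdist// F1x mul0r addr0 F0_bd ?xb; last by left.
    by nra.
  have : 0 <= 'D_(- e0) (sqdist F0 F1 y0 y1) x.
    apply: (derive_ge0_right dS ltr01) => t t01; apply: xm.
    by rewrite scalerN -scaleNr shift_e0 xb; lra.
  rewrite derive_oppv// derive_sqdist// F1x mul0r addr0 F0_bd ?xb; last by right.
  by nra.
exists x; suff [-> ->] : F0 x = y0 /\ F1 x = y1 by [].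
apply: sqdist_local_min => //; first exact/lt0r_neq0/jac_gt0.
by near=> z; apply/xm/oo_subset_cc; near: z; exact: near_open_strip.
Unshelve. all: by end_near. Qed.

Lemma F0_boundary x : 0 <= x 0 0 <= 1 -> F0 x = 0 \/ F0 x = 1 ->
  x 0 0 = 0 \/ x 0 0 = 1.
Proof.
move=> /andP[]; rewrite !le_eqVlt => /orP[/eqP|x0]; first by left.
move=> /orP[/eqP|x1]; first by right.
have /andP[f0 f1] : 0 < F0 x < 1 by apply: F0_itv; rewrite x0.
by case=> h; [rewrite h ltxx in f0|rewrite h ltxx in f1].
Qed.

(* Translations are used up by placing the first point in a fundamental domain;
   L bounds the second point. *)
Definition double_points (L : R) : set (vec * vec) :=
  [set p : vec * vec | [/\ 0 <= p.1 0 0 <= 1 /\ - (1 / 2) <= p.1 0 1 <= 1 / 2,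
               0 <= p.2 0 0 <= 1 /\ - L <= p.2 0 1 <= L,
               F0 p.1 = F0 p.2, F1 p.1 = F1 p.2 & p.1 <> p.2]].

(** The box is compact and the equations are closed conditions. The condition that the two points
    differ survives limits, since F is injective near each point of the closed strip. *)
Lemma double_points_compact (L : R) : compact (double_points L).
Proof.
pose A : set vec := [set x : vec | 0 <= x 0 0 <= 1 /\ - (1 / 2) <= x 0 1 <= 1 / 2].
pose B : set vec := [set x : vec | 0 <= x 0 0 <= 1 /\ - L <= x 0 1 <= L].
have cAB : compact (A `*` B) by apply: compact_setX; exact: compact_box.
apply: (subclosed_compact _ cAB); last by move=> [x z] [].
have clAB : closed (A `*` B).
  by apply: compact_closed cAB; exact: norm_hausdorff.
have clE (f : vec -> R) : C1 f -> closed [set p : vec * vec | f p.1 - f p.2 = 0].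
  move=> Cf; have c : continuous (fun p : vec * vec => f p.1 - f p.2).
    move=> [x z].
    have c1 : (fun p : vec * vec => f p.1) @ (x, z) --> f x.
      by apply: (@cvg_comp _ _ _ fst f _ _ _ cvg_fst); exact: (@C1_continuous _ _ f Cf).
    have c2 : (fun p : vec * vec => f p.2) @ (x, z) --> f z.
      by apply: (@cvg_comp _ _ _ snd f _ _ _ cvg_snd); exact: (@C1_continuous _ _ f Cf).
    exact: cvgB c1 c2.
  exact: (continuous_closedP _).1 c _ (@closed_eq _ 0).
move=> [x z] cl.
have [/= [x0 x1] [z0 z1]] : (A `*` B) (x, z).
  by apply: clAB; apply: closureS cl => -[? ?] [].
have EF (f : vec -> R) : C1 f -> (forall p, double_points L p -> f p.1 = f p.2) ->
    f x = f z.
  move=> Cf Hf; apply/eqP; rewrite -subr_eq0; apply/eqP.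
  apply: (clE f Cf (x, z)); apply: closureS cl => p /Hf /= ->.
  by rewrite subrr.
have E0 : F0 x = F0 z by apply: EF => // p [].
have E1 : F1 x = F1 z by apply: EF => // p [].
split=> //= xz; subst z.
have [r r0 inj] := locally_injective CF0 CF1 (lt0r_neq0 (jac_gt0 x0)).
have [[a b] [[_ _ /= Ea Eb ab]]] := cl _ (nbhsx_ballx (x, x) r r0).
rewrite -[ball _ _ _]/(ball x r a /\ ball x r b) -!ball_normE /= => -[xa xb].
by apply: ab; exact: inj.
Qed.

Lemma strip_map_inj x z : 0 < x 0 0 < 1 -> 0 < z 0 0 < 1 ->
  F0 x = F0 z -> F1 x = F1 z -> x = z.
Proof.
move=> x01 z01 E0 E1; apply: contrapT => xz.
have [K K0 HK] := F1_displacement.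
(* If F1 a = F1 b, the second coordinates of a and b differ by at most 2 K; that of a is at most 1/2
   in absolute value after translation. *)
pose L := 2 * K + 1.
have normalize (a b : vec) : 0 < a 0 0 < 1 -> 0 < b 0 0 < 1 -> F0 a = F0 b ->
    F1 a = F1 b -> a <> b -> exists2 p, double_points L p & F0 p.1 = F0 a.
  move=> a01 b01 Ea Eb ab.
  have [k hk] := int_shift (a 0 1).
  have F0k (c : vec) : F0 (c + k%:~R *: e1) = F0 c.
    have F0p (y : vec) : F0 (y + e1) = F0 y + 0 by rewrite addr0.
    by rewrite (periodicZ F0p) mulr0 addr0.
  exists (a + k%:~R *: e1, b + k%:~R *: e1) => //=.
  have h1 (c : vec) : (c + k%:~R *: e1) 0 1 = c 0 1 + k%:~R by rewrite !mxE/= mulr1.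
  rewrite /double_points; split; rewrite /= ?shift_e1 ?h1 ?F0k//.
  - by split; [exact: oo_subset_cc|move: hk => /andP[-> /ltW ->]].
  - split; first exact: oo_subset_cc.
    have := HK a (oo_subset_cc a01); have := HK b (oo_subset_cc b01).
    rewrite Eb !ler_norml /L => /andP[b1 b2] /andP[a1 a2].
    by move: hk => /andP[k1 k2]; apply/andP; split; lra.
  - by rewrite !(periodicZ F1_periodic) Eb.
  - by move/addIr.
have P0 : double_points L !=set0.
  by have [p ? _] := normalize x z x01 z01 E0 E1 xz; exists p.
have cF : continuous (fun p : vec * vec => F0 p.1).
  move=> [a b]; apply: (@cvg_comp _ _ _ fst F0 _ _ _ cvg_fst).
  exact: (@C1_continuous _ _ F0 CF0).
have [[u w]] := compact_EVT_min P0 (@double_points_compact L)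
  (continuous_subspaceT cF).
move=> /set_mem[/= [u0 u1] [w0 w1] Eu Ew uw] uwm.
(* No double point touches the boundary: equal values of [F0] put both points on the same boundary
   line, where F is injective. *)
have uwP (a b : vec) : F0 a = F0 b -> a 0 0 = 0 \/ a 0 0 = 1 -> 0 <= b 0 0 <= 1 ->
    F1 a = F1 b -> a = b.
  move=> Eab ab b0 E1ab.
  have bb : b 0 0 = 0 \/ b 0 0 = 1.
    by apply: F0_boundary => //; rewrite -Eab F0_bd.
  by apply: boundary_inj => //; rewrite -(F0_bd ab) -(F0_bd bb).
have interior (a : vec) : 0 <= a 0 0 <= 1 -> ~ (a 0 0 = 0 \/ a 0 0 = 1) -> 0 < a 0 0 < 1.
  move=> /andP[a0 a1] nb; rewrite !lt_neqAle a0 a1 !andbT.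
  by apply/andP; split; apply/eqP => h; apply: nb; [left|right].
have u01 : 0 < u 0 0 < 1 by apply: interior => // ub; apply: uw; exact: uwP.
have w01 : 0 < w 0 0 < 1.
  by apply: interior => // wb; apply: uw; apply/esym/uwP.
have [ru /= ru0 Hu] := (nbhs_normP _ _).1 (near_open_strip u01).
have [rw /= rw0 Hw] := (nbhs_normP _ _).1 (near_open_strip w01).
have uw0 : 0 < `|u - w| by rewrite normr_gt0 subr_eq0; apply/eqP.
(* The balls of radius r around u and w lie in the open strip and are disjoint, so the preimages
   found in them are distinct. *)
pose r := Num.min (Num.min ru rw) (`|u - w| / 2).
have r0 : 0 < r by rewrite !lt_min ru0 rw0 divr_gt0.
have Su (a : vec) : `|u - a| < r -> 0 < a 0 0 < 1.
  by rewrite !lt_min => /andP[/andP[h _] _]; exact: Hu.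
have Sw (a : vec) : `|w - a| < r -> 0 < a 0 0 < 1.
  by rewrite !lt_min => /andP[/andP[_ h] _]; exact: Hw.
have [d1 d10 Hd1] := locally_open CF0 CF1 r0
  (fun a h => lt0r_neq0 (jac_gt0 (oo_subset_cc (Su a h)))).
have [d2 d20 Hd2] := locally_open CF0 CF1 r0
  (fun a h => lt0r_neq0 (jac_gt0 (oo_subset_cc (Sw a h)))).
(* The bound s < 1 gives s^2 <= s < d1, d2, so (F0 u - s, F1 u) is attained near u and near w. *)
pose s := Num.min (Num.min d1 d2) 1 / 2.
have s0 : 0 < s by rewrite divr_gt0// !lt_min d10 d20 ltr01.
have /andP[/andP[sd1 sd2] s1] : (s < d1) && (s < d2) && (s < 1).
  by rewrite -!lt_min /s ltr_pdivrMr// ltr_pMr ?ltr1n// !lt_min d10 d20 ltr01.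
have ss : s ^+ 2 <= s by rewrite expr2 ler_piMl// ltW.
have [|| a [ua a0 a1]] := Hd1 (F0 u - s) (F1 u).
- by rewrite subKr; exact: le_lt_trans sd1.
- by rewrite subrr expr0n.
have [|| b [wb b0 b1]] := Hd2 (F0 u - s) (F1 u).
- by rewrite -Eu subKr; exact: le_lt_trans sd2.
- by rewrite -Ew subrr expr0n.
have [||||| p Pp pa] := normalize a b.
- exact: Su.
- exact: Sw.
- by rewrite a0 b0.
- by rewrite a1 b1.
- move=> ab; subst b.
  have : `|u - w| <= `|u - a| + `|w - a|.
    by rewrite [`|w - a|]distrC -{1}(subrK a u) -addrA ler_normD.
  move: ua wb; rewrite !lt_min => /andP[_ ua] /andP[_ wa].
  by rewrite leNgt (splitr `|u - w|) ltrD.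
have := uwm p (mem_set Pp); rewrite pa a0 /= lerBrDr gerDl.
by rewrite leNgt s0.
Qed.

End StripMap.

(** * Trigonometric polynomials and the Jacobian *)

Section C1Examples.
Variable R : realType.

Lemma C1_coord (j : 'I_2) : C1 (fun x : 'rV[R]_2 => x 0 j : R).
Proof.
split=> [x|v]; first exact: differentiable_coord.
rewrite [X in continuous X](_ : _ = cst (v 0 j)); first exact: cst_continuous.
apply/funext => x /=.
have := derive_mx (@derivable_id R 'rV[R]_2 x v).
by rewrite derive_id => /rowP/(_ j); rewrite mxE.
Qed.

Lemma C1_comp (V : normedModType R) (g : R -> R) (l : V -> R) :
  C1 g -> C1 l -> C1 (fun x => g (l x)).
Proof.
move=> Cg Cl; have [[dg cg] [dl cl]] := (Cg, Cl).
split=> [x|v]; first exact: (differentiable_comp (dl x) (dg (l x))).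
rewrite [X in continuous X](_ : _ = (fun x => 'D_v l x * 'D_1 g (l x))); last first.
  apply/funext => x; rewrite -[fun _ => _]/(g \o l).
  rewrite deriveE; last exact: (differentiable_comp (dl x) (dg (l x))).
  rewrite diff_comp//= (deriveE v (dl x)) (deriveE (1 : R) (dg (l x))).
  by rewrite -[in LHS](mulr1 ('d l x v)) -[_ * 1]/(_ *: (1 : R)) linearZ.
move=> x; apply: cvgM; first exact: cl.
by apply: (@cvg_comp _ _ _ l ('D_1 g) _ _ _ (@C1_continuous _ _ l Cl x)); exact: cg.
Qed.

Lemma C1_derive1 (f f' : R -> R) :
  (forall x : R, is_derive x (1 : R) f (f' x)) -> continuous f' -> C1 f.
Proof.
move=> df cf'.
have dif x : differentiable f x by apply/derivable1_diffP; case: (df x).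
split=> // v.
rewrite [X in continuous X](_ : _ = (fun x => v * f' x)); last first.
  apply/funext => x; have [_ <-] := df x; rewrite !deriveE//.
  by rewrite -[in LHS](mulr1 v) -[_ * 1]/(_ *: (1 : R)) linearZ.
by move=> x; apply: cvgM; [exact: cvg_cst|exact: cf'].
Qed.

Lemma C1_id : C1 (fun x : R => x).
Proof.
by apply: (@C1_derive1 _ (cst 1)) => x; exact: cvg_cst.
Qed.

Lemma C1_horner (p : {poly R}) : C1 (fun x => p.[x]).
Proof. exact: C1_derive1 (is_derive_poly p) (@continuous_horner R p^`()). Qed.

Lemma C1_cos : C1 (@cos R).
Proof.
apply: C1_derive1 (@is_derive_cos R) _ => x.
by apply: cvgN; exact: continuous_sin.
Qed.

Lemma C1_sin : C1 (@sin R).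
Proof. exact: C1_derive1 (@is_derive_sin R) (@continuous_cos R). Qed.

Lemma lspan_ind (V : lmodType R) (A : set V) (P : V -> Prop) :
  P 0 -> (forall c u v, A u -> P v -> P (c *: u + v)) -> forall v, lspan A v -> P v.
Proof.
move=> P0 PS v [n [c [g [Ag ->]]]].
elim: n c g Ag => [|n IH] c g Ag; first by rewrite big_ord0.
by rewrite big_ord_recl; apply: PS => //; apply: IH.
Qed.

(** The period w is general so that the lemma applies to trigonometric polynomials on the line (w =
    1) and to products on the plane (w = (0,1)). *)
Lemma C1_lspan (V : normedModType R) (A : set (V -> R^o)) (w : V) :
  (forall f, A f -> C1 (f : V -> R) /\ forall x, f (x + w) = f x) ->
  forall f, lspan A f -> C1 (f : V -> R) /\ forall x, f (x + w) = f x.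
Proof.
move=> H; apply: lspan_ind; first by split=> //; exact: C1_cst.
move=> c u v /H[Cu pu] [Cv pv]; split; last by move=> x; rewrite !fctE pu pv.
by apply: C1D Cv; apply: C1M Cu; exact: C1_cst.
Qed.

Lemma trig_polys_C1 (J : nat) (p : R -> R^o) : trig_polys J p ->
  C1 (p : R -> R) /\ forall x, p (x + 1) = p x.
Proof.
apply: C1_lspan => f.
have Cl (k : nat) : C1 (fun x : R => 2 * pi * k%:R * x).
  by apply: C1M; [exact: C1_cst|exact: C1_id].
have E (k : nat) x : 2 * pi * k%:R * (x + 1) = 2 * pi * k%:R * x + pi *+ 2 *+ k :> R.
  by rewrite mulrDr mulr1 -(mulr_natl pi 2) mulr_natr.
case=> [[->|[k _ <-]]|[k _ <-]].
- by split=> //; exact: C1_cst.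
- split; first exact: C1_comp C1_cos (Cl k).
  by move=> x; rewrite E (periodicn (@cosD2pi R)).
- split; first exact: C1_comp C1_sin (Cl k).
  by move=> x; rewrite E (periodicn (@sinD2pi R)).
Qed.

Lemma Whf_theta_C1 (Jr Jf : nat) (p : 'rV[R]_2 -> R^o) : Whf_theta Jr Jf p ->
  C1 (p : 'rV[R]_2 -> R) /\ forall x, p (x + vec2 0 1) = p x.
Proof.
apply: C1_lspan => f [p1 [p2 [[q [_ ->]] /trig_polys_C1[C2 per] ->]]]; split.
  apply: C1M; first exact: C1_comp (C1_horner q) (C1_coord 0).
  exact: C1_comp C2 (C1_coord 1).
by move=> x; rewrite !mxE/= addr0 per.
Qed.

(** The increment c cancels in the difference quotients. *)
Lemma derive_periodic (V W : normedModType R) (f : V -> W) (w v : V) (c : W) :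
  (forall x, f (x + w) = f x + c) -> forall x, 'D_v f (x + w) = 'D_v f x.
Proof.
move=> fw x; rewrite /derive.
rewrite (_ : (fun h : R => h^-1 *: ((f \o shift (x + w)) (h *: v) - f (x + w))) =
  (fun h : R => h^-1 *: ((f \o shift x) (h *: v) - f x)))//.
by apply/funext => h /=; rewrite addrA !fw opprD addrACA subrr addr0.
Qed.

Lemma det_mx2 (A : 'M[R]_2) : \det A = A 0 0 * A 1 1 - A 0 1 * A 1 0.
Proof.
rewrite (expand_det_row _ 0) big_ord_recl big_ord1 /cofactor !det_mx11 !mxE/=.
rewrite (_ : lift 0 0 = 1); last exact: val_inj.
rewrite (_ : lift 1 0 = 0); last exact: val_inj.
by rewrite expr0 expr1 mul1r mulN1r mulrN.
Qed.

Lemma det_jacobian (F : 'rV[R]_2 -> 'rV[R]_2) x : differentiable F x ->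
  \det ('J F x) = jac (fun z => F z 0 0) (fun z => F z 0 1) x.
Proof.
move=> dF.
have J (i j : 'I_2) : 'J F x i j = 'D_(delta_mx 0 i) (fun z => F z 0 j) x.
  have := deriveEjacobian (delta_mx 0 i) dF.
  rewrite -rowE derive_mx; last exact: diff_derivable.
  by move=> /rowP/(_ j); rewrite !mxE.
have E0 : delta_mx 0 0 = vec2 (1 : R) 0 by apply: vec2_ext; rewrite !mxE.
have E1 : delta_mx 0 1 = vec2 (0 : R) 1 by apply: vec2_ext; rewrite !mxE.
by rewrite det_mx2 !J E0 E1 /jac [X in _ - X]mulrC.
Qed.

Lemma differentiable_vec2 (F : 'rV[R]_2 -> 'rV[R]_2) x :
  differentiable (fun z => F z 0 0) x -> differentiable (fun z => F z 0 1) x ->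
  differentiable F x.
Proof.
move=> d0 d1.
rewrite (_ : F = (fun z => F z 0 0 *: vec2 1 0) + (fun z => F z 0 1 *: vec2 0 1)).
  by apply: differentiableD; exact: differentiableZl.
by apply/funext => z; apply: vec2_ext; rewrite !mxE/=; ring.
Qed.

End C1Examples.

(** * Polar coordinates *)

Section Polar.
Variables (R : realType) (rin rout : R).
Hypotheses (rin_gt0 : 0 < rin) (rin_lt_rout : rin < rout).
Local Notation vec := 'rV[R]_2.
Local Notation e1 := (vec2 (0 : R) 1).
Implicit Types x y z : vec.

Lemma radius_itv (t : R) : 0 < t < 1 -> rin < rin + (rout - rin) * t < rout.
Proof.
move=> /andP[t0 t1]; have d0 : 0 < rout - rin by rewrite subr_gt0.
by rewrite ltrDl mulr_gt0//= -ltrBrDl gtr_pMr.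
Qed.

Lemma norm2_polar x : 0 < x 0 0 < 1 ->
  norm2 (polar rin rout x) = rin + (rout - rin) * x 0 0.
Proof.
move=> x01; rewrite /norm2 !mxE/= !exprMn -mulrDr cos2Dsin2 mulr1.
rewrite sqrtr_sqr ger0_norm// ltW// (lt_trans rin_gt0)//.
by have /andP[] := radius_itv x01.
Qed.

Lemma polar_annulus x : 0 < x 0 0 < 1 -> annulus rin rout (polar rin rout x).
Proof. by move=> x01; rewrite /annulus/= norm2_polar//; exact: radius_itv. Qed.

Lemma polar_periodic x (k : int) : polar rin rout (x + k%:~R *: e1) = polar rin rout x.
Proof.
have P y : polar rin rout (y + e1) = polar rin rout y.
  have E : 2 * pi * (y + e1) 0 1 = 2 * pi * y 0 1 + pi *+ 2.
    by rewrite !mxE/= mulrDr mulr1 -(mulr_natl pi 2).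
  by rewrite /polar E cosD2pi sinD2pi !mxE/= addr0.
apply: vec2_ext.
  have P0 y : polar rin rout (y + e1) 0 0 = polar rin rout y 0 0 + 0 by rewrite P addr0.
  by rewrite (periodicZ P0) mulr0 addr0.
have P1 y : polar rin rout (y + e1) 0 1 = polar rin rout y 0 1 + 0 by rewrite P addr0.
by rewrite (periodicZ P1) mulr0 addr0.
Qed.

(** After an integer shift |2 pi t| lies in [0, pi], where the cosine is injective and takes the
    value 1 at 0. *)
Lemma cos_2pi_eq1 (t : R) : cos (2 * pi * t) = 1 -> exists k : int, t = k%:~R.
Proof.
move=> ct; have [k hk] := int_shift t.
exists (- k); rewrite rmorphN/=; apply/eqP; rewrite -addr_eq0; apply/eqP.
have pi0 := pi_gt0 R.
have ck : cos (2 * pi * (t + k%:~R)) = 1.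
  have N (n : nat) (s : R) : cos (2 * pi * (s + n%:R)) = cos (2 * pi * s).
    rewrite mulrDr (_ : 2 * pi * n%:R = pi *+ 2 *+ n) ?(periodicn (@cosD2pi R))//.
    by rewrite mulr_natr -(mulr_natl pi 2).
  case: k hk => n _; first by rewrite N.
  by rewrite NegzE rmorphN/= -(N n.+1 (t - _)) subrK.
have n1 : `|t + k%:~R| <= 1 / 2.
  by rewrite ler_norml; move: hk => /andP[-> /ltW ->].
have : `|2 * pi * (t + k%:~R)| = 0.
  apply: cos_inj; rewrite ?cos_norm ?cos0// in_itv/= ?lexx ?pi_ge0// normr_ge0/=.
  by rewrite normrM ger0_norm ?mulr_ge0 ?pi_ge0//; nra.
move/normr0_eq0/eqP; rewrite mulf_eq0 mulf_eq0 pnatr_eq0/= gt_eqF//=.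
by move/eqP.
Qed.

(** Norms determine the radial coordinate; the cosine of the difference of the angles is then cos^2
    + sin^2 = 1. *)
Lemma polar_eq x z : 0 < x 0 0 < 1 -> 0 < z 0 0 < 1 ->
  polar rin rout x = polar rin rout z -> exists k : int, z = x + k%:~R *: e1.
Proof.
move=> x01 z01 E.
have xz : x 0 0 = z 0 0.
  have := congr1 (@norm2 R) E; rewrite !norm2_polar// => /addrI/mulfI; apply.
  by rewrite gt_eqF// subr_gt0.
have r0 : rin + (rout - rin) * x 0 0 != 0.
  by rewrite gt_eqF// (lt_trans rin_gt0)//; have /andP[] := radius_itv x01.
have := congr1 (fun v : vec => v 0 1) E; have := congr1 (fun v : vec => v 0 0) E.
rewrite !mxE/= -xz => /(mulfI r0) c /(mulfI r0) s.
have [|k hk] := @cos_2pi_eq1 (z 0 1 - x 0 1).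
  by rewrite mulrBr cosB c s -!expr2 cos2Dsin2.
by exists k; apply: vec2_ext; rewrite !mxE/= ?mulr0 ?addr0// mulr1 -hk addrC subrK.
Qed.

(** The angle is [acos c], with its sign chosen to match that of s. *)
Lemma unit_circle (c s : R) : c ^+ 2 + s ^+ 2 = 1 ->
  exists t : R, cos (2 * pi * t) = c /\ sin (2 * pi * t) = s.
Proof.
move=> cs; have c1 : -1 <= c <= 1 by apply/andP; split; nra.
have pi0 : 2 * pi != 0 :> R by rewrite mulf_neq0 ?pnatr_eq0// gt_eqF// pi_gt0.
have sE : Num.sqrt (1 - c ^+ 2) = `|s| by rewrite -cs addrC addKr sqrtr_sqr.
have [s0|s0] := lerP 0 s.
  exists (acos c / (2 * pi)); rewrite mulrC divfK// sin_acos// sE ger0_norm//.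
  by rewrite acosK// in_itv.
exists (- acos c / (2 * pi)); rewrite mulrC divfK// cosN sinN sin_acos// sE.
by rewrite ltr0_norm// opprK acosK// in_itv.
Qed.

Lemma polar_surj y : annulus rin rout y ->
  exists x, [/\ 0 < x 0 0 < 1, - (1 / 2) <= x 0 1 < 1 / 2 & polar rin rout x = y].
Proof.
rewrite /annulus/=; set n := norm2 y => /andP[n1 n2].
have n0 : n != 0 by rewrite gt_eqF// (lt_trans rin_gt0 n1).
have nE : n ^+ 2 = y 0 0 ^+ 2 + y 0 1 ^+ 2.
  by rewrite sqr_sqrtr// addr_ge0// sqr_ge0.
have [|t [ct st]] := @unit_circle (y 0 0 / n) (y 0 1 / n).
  by rewrite !expr_div_n -mulrDl -nE divff// expf_neq0.
have d0 : 0 < rout - rin by rewrite subr_gt0.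
pose x := vec2 ((n - rin) / (rout - rin)) t.
have x0 : 0 < x 0 0 < 1.
  by rewrite vec2E divr_gt0 ?subr_gt0//= ltr_pdivrMr// mul1r ltrD2r.
have [k hk] := int_shift t.
exists (x + k%:~R *: e1); split.
- by rewrite !mxE/= mulr0 addr0 -[X in 0 < X < 1](vec2_0 _ t).
- by rewrite !mxE/= mulr1.
rewrite polar_periodic; apply: vec2_ext; rewrite !mxE/= ?ct ?st;
  by rewrite mulrC (mulrC (rout - rin)) divfK ?gt_eqF// addrC subrK divfK.
Qed.

(** By [polar_surj] the defining set is inhabited, so [xget] does not fall back on its default 0. *)
Lemma inv_polarP y : annulus rin rout y ->
  [/\ 0 < inv_polar rin rout y 0 0 < 1,
      - (1 / 2) <= inv_polar rin rout y 0 1 < 1 / 2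
    & polar rin rout (inv_polar rin rout y) = y].
Proof. by move=> /polar_surj; exact: (@xgetPex _ 0 [set x : vec | [/\ _, _ & _]]). Qed.

(** On the strip, [inv_polar] inverts [polar] only up to the translation that brings the angle into
    [-1/2, 1/2). *)
Lemma inv_polar_shift x : 0 < x 0 0 < 1 ->
  exists k : int, inv_polar rin rout (polar rin rout x) = x + k%:~R *: e1.
Proof.
move=> x01; have [z01 _ E] := inv_polarP (polar_annulus x01).
exact: polar_eq.
Qed.

End Polar.

(** * From the strip to the annulus *)

(* The library's jacobian acts on row vectors, so it is the transpose of the
   usual Jacobian matrix; the determinant is the same. *)
Theorem proposition2p2 (R : realType) (rin rout : R)
  (rin_gt0 : 0 < rin) (rin_lt_rout : rin < rout)
  (Jr Jf : nat) (Jr_gt0 : (0 < Jr)%N) (Jf_gt0 : (0 < Jf)%N)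
  (M : nat) (M_ge1 : (1 <= M)%N)
  (W : {linear 'rV[R]_M -> ('rV[R]_2 -> 'rV[R]_2)})
  (W_Whf : forall a, Whf_pol Jr Jf (W a))
  (a : 'rV[R]_M)
  (Phi_pol : 'rV[R]_2 -> 'rV[R]_2)
  (Phi_polE : Phi_pol = (fun x => x + W a x))
  (Phi : 'rV[R]_2 -> 'rV[R]_2)
  (PhiE : Phi = polar rin rout \o Phi_pol \o inv_polar rin rout)
  (det_gt0 : forall x : 'rV[R]_2,
     0 <= x 0 0 <= 1 -> - (1 / 2) <= x 0 1 <= 1 / 2 ->
     0 < \det ('J Phi_pol x)) :
  set_bij (annulus rin rout) (annulus rin rout) Phi.
Proof.
pose F0 (x : 'rV[R]_2) : R := Phi_pol x 0 0.
pose F1 (x : 'rV[R]_2) : R := Phi_pol x 0 1.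
have [[W0 W0_bd] W1] := W_Whf a.
have [CW0 pW0] := Whf_theta_C1 W0; have [CW1 pW1] := Whf_theta_C1 W1.
have F0E x : F0 x = x 0 0 + W a x 0 0 by rewrite /F0 Phi_polE mxE.
have F1E x : F1 x = x 0 1 + W a x 0 1 by rewrite /F1 Phi_polE mxE.
have CF0 : C1 F0 by rewrite (funext F0E); exact: C1D (C1_coord _ 0) CW0.
have CF1 : C1 F1 by rewrite (funext F1E); exact: C1D (C1_coord _ 1) CW1.
have F0p x : F0 (x + vec2 0 1) = F0 x by rewrite !F0E pW0 !mxE/= addr0.
have F1p x : F1 (x + vec2 0 1) = F1 x + 1.
  by rewrite !F1E pW1 [in LHS]mxE vec2_1 addrAC.
have F0_bd (x : 'rV[R]_2) : x 0 0 = 0 \/ x 0 0 = 1 -> F0 x = x 0 0.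
  by move=> xb; rewrite F0E (W0_bd x xb) addr0.
have dF x : differentiable Phi_pol x.
  by apply: differentiable_vec2; [exact: CF0.1|exact: CF1.1].
(* Positivity is assumed on one period and spreads to the strip by periodicity of the
   derivatives. *)
have jac_gt0 (x : 'rV[R]_2) : 0 <= x 0 0 <= 1 -> 0 < jac F0 F1 x.
  move=> x01; have [k hk] := int_shift (x 0 1).
  have per f (c : R) v (z : 'rV[R]_2) : (forall x, f (x + vec2 0 1) = f x + c) ->
      'D_v f (z + k%:~R *: vec2 0 1) = 'D_v f z.
    move=> fp; apply: (@derive_periodic _ _ _ f _ _ (k%:~R * c)) => y.
    exact: periodicZ.
  have F0p' z : F0 (z + vec2 0 1) = F0 z + 0 by rewrite addr0.
  rewrite /jac -!(per F0 _ _ x F0p') -!(per F1 _ _ x F1p).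
  rewrite -[X in 0 < X]/(jac F0 F1 _) -det_jacobian//; apply: det_gt0.
    by rewrite shift_e1.
  by rewrite !mxE/= mulr1; move: hk => /andP[-> /ltW ->].
have Phi_shift x (k : int) :
    Phi_pol (x + k%:~R *: vec2 0 1) = Phi_pol x + k%:~R *: vec2 0 1.
  have F0p' z : F0 (z + vec2 0 1) = F0 z + 0 by rewrite addr0.
  apply: vec2_ext; rewrite [in RHS]mxE [X in _ = _ + X]mxE vec2E.
    exact: (periodicZ F0p').
  exact: (periodicZ F1p).
have Phi01 (x : 'rV[R]_2) : 0 < x 0 0 < 1 -> 0 < Phi_pol x 0 0 < 1.
  exact: (F0_itv CF0 F0p F0_bd jac_gt0).
rewrite PhiE; split.
- move=> y /(inv_polarP rin_gt0 rin_lt_rout)[x01 _ _] /=.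
  by apply: polar_annulus => //; exact: Phi01.
- move=> y y' /set_mem Ay /set_mem Ay' /=.
  have [x01 xh Ex] := inv_polarP rin_gt0 rin_lt_rout Ay.
  have [z01 zh Ez] := inv_polarP rin_gt0 rin_lt_rout Ay'.
  (* Equal images under [polar] differ by an integer translation; [Phi_shift] moves it to the
     argument, and injectivity on the strip applies. *)
  move=> /(polar_eq rin_gt0 rin_lt_rout (Phi01 _ x01) (Phi01 _ z01))[k].
  rewrite -Phi_shift => E.
  have sk : 0 < (inv_polar rin rout y + k%:~R *: vec2 0 1) 0 0 < 1 by rewrite shift_e1.
  have zx : inv_polar rin rout y' = inv_polar rin rout y + k%:~R *: vec2 0 1.
    by apply: (strip_map_inj CF0 CF1 F0p F1p F0_bd jac_gt0) => //; rewrite /F0 /F1 E.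
  by rewrite -Ex -Ez zx polar_periodic.
- move=> y Ay.
  have [z [z01 _ Ez]] := polar_surj rin_gt0 rin_lt_rout Ay.
  have [x [x01 x0 x1]] := strip_map_surj CF0 CF1 F0p F1p F0_bd jac_gt0 (z 0 1) z01.
  have Ex : Phi_pol x = z by exact: vec2_ext.
  exists (polar rin rout x); first exact: polar_annulus.
  (* The translation introduced by [inv_polar] passes through [Phi_pol] and is absorbed by
     [polar]. *)
  have [k /= ->] := inv_polar_shift rin_gt0 rin_lt_rout x01.
  by rewrite Phi_shift polar_periodic Ex.
Qed.
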